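(* Let $n\ge1$, let $c_1,\dots,c_n$ and $M$ be positive real constants, and let $S=\{x\in\mathbb{R}^n_{\ge0}: c_1x_1+c_2x_2+\cdots+c_nx_n=M\}$. Then $$\mathrm{OPT}(S)=\frac{\max_{1\le i\le n} c_i}{\min_{1\le i\le n} c_i}.$$
   Context: Notation: $\mathbb{R}^n_{\ge0}=\{x\in\mathbb{R}^n: x_i\ge 0 \text{ for all } i\}$; $x\le y$ means $x_i\le y_i$ for all $i$; $\min(x,y)$ and $\max(x,y)$ are taken coordinatewise; $e_i$ is the $i$-th unit vector. EL function: a function $f:\mathbb{R}^n_{\ge0}\to\mathbb{R}$ is entropy-like (EL) if (1) it is submodular: $f(x)+f(y)\ge f(\min(x,y))+f(\max(x,y))$ for all $x,y\in\mathbb{R}^n_{\ge0}$; (2) $f(0)=0$; (3) $f$ is non-decreasing: $0\le x\le y$ implies $f(x)\le f(y)$; (4) it has the Diminishing Returns property: for every $x\ge0$, every $i$, every $\lambda>0$ and $\varepsilon>0$, with $y=x+\lambda e_i$, one has $f(x+\varepsilon e_i)-f(x)\ge f(y+\varepsilon e_i)-f(y)$. Left and right partial derivatives: $f^-_i(x)=\lim_{\varepsilon\to+0}\frac{f(x)-f(x-\varepsilon e_i)}{\varepsilon}$ (for $x_i>0$) and $f^+_i(x)=\lim_{\varepsilon\to+0}\frac{f(x+\varepsilon e_i)-f(x)}{\varepsilon}$; the value $+\infty$ is allowed for $f_i^+$ when $x_i=0$. Cost: $\mathrm{Cost}(f)=\max\{f^+_1(0),\dots,f^+_n(0)\}$,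 which may be $+\infty$. Feasibility: an EL function $f$ is $S$-feasible if $f^-_i(x)-f^+_i(x)\ge1$ for all $1\le i\le n$ and all $x\in S$ with all coordinates strictly positive. $\mathrm{OPT}(S)$ is the infimum of $\mathrm{Cost}(f)$ over all $S$-feasible EL functions $f$ ($+\infty$ if there are none). *)

(* Defs.v *)
From mathcomp Require Import all_boot all_order all_algebra.
From mathcomp Require Import all_classical all_reals all_analysis.

Set Implicit Arguments.
Unset Strict Implicit.
Unset Printing Implicit Defensive.

Import Order.TTheory GRing.Theory Num.Theory.
Import numFieldNormedType.Exports.

Local Open Scope classical_set_scope.
Local Open Scope ring_scope.

(* A function on the nonnegative orthant is represented by a total function on
   'rV[R]_n.  Everything below only constrains or reads its values on the
   orthant: the left difference quotient at x is taken along eps -> 0+, and it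
   is only used where x 0 i > 0. *)

Definition nonneg_vec (R : realType) (n : nat) (x : 'rV[R]_n) : Prop :=
  forall i, 0 <= x 0 i.

Definition le_vec (R : realType) (n : nat) (x y : 'rV[R]_n) : Prop :=
  forall i, x 0 i <= y 0 i.

Definition min_vec (R : realType) (n : nat) (x y : 'rV[R]_n) : 'rV[R]_n :=
  \row_i Num.min (x 0 i) (y 0 i).

Definition max_vec (R : realType) (n : nat) (x y : 'rV[R]_n) : 'rV[R]_n :=
  \row_i Num.max (x 0 i) (y 0 i).

Definition unit_vec (R : realType) (n : nat) (i : 'I_n) : 'rV[R]_n :=
  delta_mx 0 i.
Arguments unit_vec {R n} i.

Definition submodular (R : realType) (n : nat) (f : 'rV[R]_n -> R) : Prop :=
  forall x y, nonneg_vec x -> nonneg_vec y ->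
    f (min_vec x y) + f (max_vec x y) <= f x + f y.

Definition nondecreasing_vec (R : realType) (n : nat)
    (f : 'rV[R]_n -> R) : Prop :=
  forall x y, nonneg_vec x -> le_vec x y -> f x <= f y.

Definition diminishing_returns (R : realType) (n : nat)
    (f : 'rV[R]_n -> R) : Prop :=
  forall (x : 'rV[R]_n) (i : 'I_n) (lambda eps : R),
    nonneg_vec x -> 0 < lambda -> 0 < eps ->
    let y := x + lambda *: unit_vec i in
    f (y + eps *: unit_vec i) - f y <= f (x + eps *: unit_vec i) - f x.

Definition entropy_like (R : realType) (n : nat) (f : 'rV[R]_n -> R) : Prop :=
  [/\ submodular f, f 0 = 0, nondecreasing_vec f & diminishing_returns f].

(* The limits are taken in \bar R, so that +oo is a possible value.  For an
   entropy-like f they exist, because f is then concave and nondecreasing in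
   each coordinate; both are finite when x 0 i > 0. *)

Definition left_partial (R : realType) (n : nat) (f : 'rV[R]_n -> R)
    (i : 'I_n) (x : 'rV[R]_n) : \bar R :=
  lim (((f x - f (x - eps *: unit_vec i)) / eps)%:E @[eps --> (0 : R)^'+]).

Definition right_partial (R : realType) (n : nat) (f : 'rV[R]_n -> R)
    (i : 'I_n) (x : 'rV[R]_n) : \bar R :=
  lim (((f (x + eps *: unit_vec i) - f x) / eps)%:E @[eps --> (0 : R)^'+]).

(* -oo is the neutral element of maxe; it is the value only when n = 0. *)
Definition Cost (R : realType) (n : nat) (f : 'rV[R]_n -> R) : \bar R :=
  \big[maxe/-oo%E]_(i < n) right_partial f i 0.

Definition feasible (R : realType) (n : nat) (S : set 'rV[R]_n)
    (f : 'rV[R]_n -> R) : Prop :=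
  entropy_like f /\
  forall (i : 'I_n) (x : 'rV[R]_n), S x -> (forall j, 0 < x 0 j) ->
    (1%:E <= left_partial f i x - right_partial f i x)%E.

(* ereal_inf set0 = +oo *)
Definition OPT (R : realType) (n : nat) (S : set 'rV[R]_n) : \bar R :=
  ereal_inf [set Cost f | f in [set f | feasible S f]].

(* Main.v *)
Require Import Defs.
From mathcomp Require Import all_boot all_order all_algebra.
From mathcomp Require Import all_classical all_reals all_analysis.
From mathcomp Require Import ring lra.

Import Order.TTheory GRing.Theory Num.Theory.
Import numFieldNormedType.Exports.

Local Open Scope classical_set_scope.
Local Open Scope ring_scope.

(** Upper bound. Write m for the least c_i. The function min (c . x, M) / m
    (truncated_weight) is entropy-like because it is a concave function of a
    nonnegative linear form. Across the simplex its i-th partial derivative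
    drops from c_i / m >= 1 to 0, and its cost is the largest c_i divided by m.

    Lower bound. Heuristically, the gradient of a continuous function can jump
    across a hyperplane only along the normal c, so a jump of at least 1 in the
    coordinate b of the least c_b forces a jump of at least k = c_a / c_b in
    the coordinate a of the largest c_a; as f is nondecreasing, its derivative
    along e_a before the jump is then at least k, and hence so is f_a^+(0),
    because increments shrink away from the origin.  Since an entropy-like f
    need not be differentiable, the argument is discretized (staircase). Points
    P_0, P_1, ... of the simplex are spaced by h e_a - k h e_b. At each of them
    feasibility makes the second difference along e_b with step k h at least
    k h (second_difference_ge), while the second difference along e_a with
    step h is at most h C if Cost f <= C (increment_le_cost). The two second
    differences at P_i differ by a telescoping term U_{i+1} - U_i, and the U_i
    are of order h; summing over N + 1 points shows that (N + 1) (k - C) is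
    bounded independently of N, so k <= C.

    The one-sided derivatives are limits in the extended reals, and they are
    compared with difference quotients by concavity along coordinate lines
    (secant_le), which follows from diminishing returns together with
    monotonicity. *)

(** * Two facts about real numbers *)

Lemma le0_of_bounded_multiples (R : realType) (a b : R) :
  (forall N : nat, N.+1%:R * a <= b) -> a <= 0.
Proof.
move=> Hab; rewrite leNgt; apply/negP => a0.
have /= := Num.Theory.truncnS_gt (b / a); rewrite ltr_pdivrMr // => H.
by have := lt_le_trans H (Hab _); rewrite ltxx.
Qed.

(** The concavity of t |-> min (t, K), in the form used both for submodularity
    and for diminishing returns: spreading p and q apart to a and b, with the
    same sum, cannot increase the sum of the values. *)
Lemma min_decreasing_increments (R : realType) (K a p q b : R) :
  a <= p -> a <= q -> a + b = p + q ->
  Num.min a K + Num.min b K <= Num.min p K + Num.min q K.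
Proof.
by case: (leP a K) (leP b K) (leP p K) (leP q K) => [?|?] [?|?] [?|?] [?|?]; lra.
Qed.

(** * Entropy-like functions along coordinate lines *)

Section EntropyLike.
Set Implicit Arguments.
Unset Strict Implicit.
Context {R : realType} {n : nat}.
Implicit Types (x y : 'rV[R]_n) (i j : 'I_n) (f : 'rV[R]_n -> R).

Lemma unit_vecE i j : (unit_vec i : 'rV[R]_n) 0 j = (j == i)%:R.
Proof. by rewrite /unit_vec mxE eqxx. Qed.

Lemma addZunitE x i (t : R) j :
  (x + t *: unit_vec i) 0 j = x 0 j + t * (j == i)%:R.
Proof. by rewrite mxE mxE unit_vecE. Qed.

Lemma nonneg_addZunit x i (t : R) :
  nonneg_vec x -> 0 <= x 0 i + t -> nonneg_vec (x + t *: unit_vec i).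
Proof.
move=> x0 xit j; rewrite addZunitE.
by case: (eqVneq j i) => [->|_]; rewrite ?mulr1 // mulr0 addr0.
Qed.

Lemma addZunitD x i (s t : R) :
  x + s *: unit_vec i + t *: unit_vec i = x + (s + t) *: unit_vec i.
Proof. by rewrite -addrA -scalerDl. Qed.

Lemma nondecreasing_unit f x i (s t : R) : nondecreasing_vec f ->
  nonneg_vec x -> 0 <= x 0 i + s -> s <= t ->
  f (x + s *: unit_vec i) <= f (x + t *: unit_vec i).
Proof.
move=> fm x0 xis st; apply: fm; first exact: nonneg_addZunit.
by move=> j; rewrite !addZunitE lerD2l; apply: ler_wpM2r.
Qed.

(** On the arithmetic progression x + (j d) e_i the increments of f decrease,
    by diminishing returns with lambda = eps = d; hence the average increment
    over the first m steps decreases with m. *)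
Lemma multiples_secant f x i (d : R) : entropy_like f -> nonneg_vec x -> 0 < d ->
  forall N m : nat, (0 < N <= m)%N ->
  N%:R * (f (x + (m%:R * d) *: unit_vec i) - f x) <=
  m%:R * (f (x + (N%:R * d) *: unit_vec i) - f x).
Proof.
move=> [_ _ fm fdr] x0 d0.
pose a (j : nat) := f (x + (j%:R * d) *: unit_vec i) - f x.
have D_le (j : nat) : a j.+2 - a j.+1 <= a j.+1 - a j.
  rewrite /a; have xj0 : nonneg_vec (x + (j%:R * d) *: unit_vec i).
    by apply: nonneg_addZunit => //; rewrite addr_ge0// mulr_ge0// ltW.
  have /= := fdr _ i d d xj0 d0 d0; rewrite !addZunitD addrA.
  have -> : j%:R * d + d = j.+1%:R * d by rewrite -natr1; ring.
  have -> : j.+1%:R * d + d = j.+2%:R * d by rewrite -[j.+2%:R]natr1; ring.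
  lra.
have a0 : a 0%N = 0 by rewrite /a mul0r scale0r addr0 subrr.
(* The last increment is at most the average of those before it. *)
have jD (j : nat) : j%:R * (a j.+1 - a j) <= a j.
  elim: j => [|j IH]; first by rewrite mul0r a0.
  have := ler_wpM2l (ler0n R j.+1) (D_le j); rewrite -natr1; nra.
have step (j : nat) : j%:R * a j.+1 <= j.+1%:R * a j.
  by have := jD j; rewrite -[j.+1%:R]natr1; nra.
move=> N m /andP[N0]; rewrite -!/(a _).
elim: m => [|m IH]; first by rewrite leqNgt N0.
rewrite leq_eqVlt => /orP[/eqP -> //|]; rewrite ltnS => Nm.
have m0 : 0 < m%:R :> R by rewrite ltr0n (leq_trans N0).
rewrite -(ler_pM2l m0).
have h1 := ler_wpM2l (ler0n R N) (step m).
have h2 := ler_wpM2l (ler0n R m.+1) (IH Nm).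
by apply: le_trans (_ : N%:R * (m.+1%:R * a m) <= _); lra.
Qed.

(** Concavity along e_i. Commensurable steps are compared by
    multiples_secant; in general t is rounded up to a multiple of
    d = s / (N + 1), which costs at most d since f is nondecreasing, and N
    tends to infinity. *)
Lemma secant_le f x i (s t : R) : entropy_like f -> nonneg_vec x ->
  0 < s -> s <= t ->
  s * (f (x + t *: unit_vec i) - f x) <= t * (f (x + s *: unit_vec i) - f x).
Proof.
move=> fEL x0 s0 st; have [_ _ fm _] := fEL.
set T := f _ - f x; set A := f _ - f x.
have t0 : 0 < t by exact: lt_le_trans st.
have A0 : 0 <= A.
  rewrite subr_ge0 -{1}[x]addr0 -(scale0r (unit_vec i)).
  by apply: nondecreasing_unit => //; rewrite ?addr0 // ltW.
rewrite -subr_le0; apply: (le0_of_bounded_multiples _ _ (s * A)) => N.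
pose d := s / N.+1%:R.
have d0 : 0 < d by rewrite divr_gt0.
have Nd : N.+1%:R * d = s by rewrite /d mulrC divfK.
have td0 : 0 <= t / d by rewrite divr_ge0 ?ltW.
have /andP[Kl Ku] := truncn_itv td0.
set K := Num.truncn _ in Kl Ku.
rewrite ler_pdivlMr // in Kl; rewrite ltr_pdivrMr // in Ku.
have NK : (N.+1 <= K.+1)%N.
  rewrite -(ler_nat R) -(ler_pM2r d0) Nd; exact: le_trans st (ltW Ku).
have := @multiples_secant f x i d fEL x0 d0 N.+1 K.+1.
rewrite NK Nd -/A => /(_ isT) H.
have TK : T <= f (x + (K.+1%:R * d) *: unit_vec i) - f x.
  rewrite lerB //; apply: nondecreasing_unit => //; last exact: ltW.
  by rewrite addr_ge0 // ltW.
have H1 : N.+1%:R * T <= K.+1%:R * A.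
  by apply: le_trans H; rewrite ler_wpM2l.
have H2 : K.+1%:R * d <= t + d by rewrite -natr1; nra.
have H3 : N.+1%:R * (K.+1%:R * d) <= N.+1%:R * t + s.
  by rewrite -Nd; have := ler_wpM2l (ler0n R N.+1) H2; rewrite mulrDr.
have H4 : s * (N.+1%:R * T) <= s * (K.+1%:R * A) by rewrite ler_wpM2l // ltW.
have H5 : s * K.+1%:R * A <= (N.+1%:R * t + s) * A.
  by rewrite ler_wpM2r //; rewrite -{1}Nd; lra.
lra.
Qed.

Lemma right_quotient_le f x i (s t : R) : entropy_like f -> nonneg_vec x ->
  0 < s -> s <= t ->
  (f (x + t *: unit_vec i) - f x) / t <= (f (x + s *: unit_vec i) - f x) / s.
Proof.
move=> fEL x0 s0 st; have t0 : 0 < t by exact: lt_le_trans st.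
rewrite ler_pdivrMr // mulrAC ler_pdivlMr //.
by rewrite mulrC [leRHS]mulrC; exact: secant_le.
Qed.

(** The same concavity, with the secants based at x - t e_i. *)
Lemma left_quotient_le f x i (s t : R) : entropy_like f -> nonneg_vec x ->
  0 < s -> s <= t -> t <= x 0 i ->
  (f x - f (x - s *: unit_vec i)) / s <= (f x - f (x - t *: unit_vec i)) / t.
Proof.
move=> fEL x0 s0 st tx; have t0 : 0 < t by exact: lt_le_trans st.
rewrite ler_pdivrMr // mulrAC ler_pdivlMr //.
have [<-|nst] := eqVneq s t; first by [].
have y0 : nonneg_vec (x - t *: unit_vec i).
  by rewrite -scaleNr; apply: nonneg_addZunit => //; rewrite subr_ge0.
have := @secant_le f _ i (t - s) t fEL y0; rewrite -scaleNr !addZunitD.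
rewrite subr_gt0 lt_neqAle nst st => /(_ isT) H.
have : t - s <= t by lra.
move=> /H; rewrite addNr scale0r addr0 addrA addNr add0r !scaleNr; lra.
Qed.

(** The quotients increase as the step shrinks, so the limit exists in the
    extended reals and dominates each of them. *)
Lemma right_partial_ge f x i (h : R) : entropy_like f -> nonneg_vec x -> 0 < h ->
  (((f (x + h *: unit_vec i) - f x) / h)%:E <= right_partial f i x)%E.
Proof.
move=> fEL x0 h0; apply: lime_ge.
  apply: nonincreasing_at_right_is_cvge; near=> z => s t /=.
  rewrite !in_itv /= => /andP[s0 _] _ st.
  by rewrite lee_fin; exact: right_quotient_le.
near=> s; rewrite lee_fin; apply: right_quotient_le => //.
by near: s; exact: nbhs_right_le.
Unshelve. all: by end_near. Qed.

Lemma left_partial_le f x i (h : R) : entropy_like f -> nonneg_vec x ->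
  0 < h -> h <= x 0 i ->
  (left_partial f i x <= ((f x - f (x - h *: unit_vec i)) / h)%:E)%E.
Proof.
move=> fEL x0 h0 hx; apply: lime_le.
  apply: nondecreasing_at_right_is_cvge; near=> z => s t /=.
  rewrite !in_itv /= => /andP[s0 _] /andP[_ tz] st.
  rewrite lee_fin; apply: left_quotient_le => //; apply: le_trans hx.
  apply: le_trans (ltW tz) _.
  by near: z; exact: nbhs_right_le.
near=> s; rewrite lee_fin; apply: left_quotient_le => //.
by near: s; exact: nbhs_right_le.
Unshelve. all: by end_near. Qed.

(** Concavity turns the infinitesimal drop of the partial derivative required
    by feasibility into a bound at every finite step h. *)
Lemma second_difference_ge f x i (h : R) : entropy_like f -> nonneg_vec x ->
  0 < h -> h <= x 0 i ->
  (1%:E <= left_partial f i x - right_partial f i x)%E ->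
  h <= 2 * f x - f (x - h *: unit_vec i) - f (x + h *: unit_vec i).
Proof.
move=> fEL x0 h0 hx drop.
have := le_trans drop (leeB (left_partial_le fEL x0 h0 hx)
                            (right_partial_ge i fEL x0 h0)).
by rewrite -EFinB lee_fin -mulrBl ler_pdivlMr // mul1r; lra.
Qed.

(** Submodularity for x and (x_i + h) e_i reduces the base point x to its
    projection x_i e_i on the axis, and diminishing returns moves x_i e_i
    to 0. *)
Lemma increment_le_at0 f x i (h : R) : entropy_like f -> nonneg_vec x -> 0 < h ->
  f (x + h *: unit_vec i) - f x <= f (0 + h *: unit_vec i) - f 0.
Proof.
move=> [fs f0 fm fdr] x0 h0.
have z0 : nonneg_vec (0 : 'rV[R]_n) by move=> j; rewrite mxE.
have y0 : nonneg_vec (0 + (x 0 i + h) *: unit_vec i : 'rV[R]_n).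
  by apply: nonneg_addZunit => //; rewrite mxE add0r addr_ge0 ?x0 // ltW.
have := fs _ _ x0 y0.
have -> : min_vec x (0 + (x 0 i + h) *: unit_vec i) = 0 + x 0 i *: unit_vec i.
  apply/rowP => j; rewrite mxE !addZunitE mxE !add0r.
  case: (eqVneq j i) => [->|_]; rewrite ?mulr1 ?mulr0; first by apply: min_l; lra.
  exact: min_r.
have -> : max_vec x (0 + (x 0 i + h) *: unit_vec i) = x + h *: unit_vec i.
  apply/rowP => j; rewrite mxE !addZunitE mxE !add0r.
  case: (eqVneq j i) => [->|_]; rewrite ?mulr1 ?mulr0 ?addr0; first by apply: max_r; lra.
  exact: max_l.
move=> sub.
have [xi0|xi0] := eqVneq (x 0 i) 0.
  by move: sub; rewrite xi0 scale0r addr0 !add0r; lra.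
have xi_gt0 : 0 < x 0 i by rewrite lt_def xi0 x0.
have /= := fdr 0 i _ h z0 xi_gt0 h0; rewrite addZunitD; lra.
Qed.

(** The cost is a Lipschitz constant of f in every coordinate direction. *)
Lemma increment_le_cost f (C : R) x i (h : R) : entropy_like f ->
  (Cost f <= C%:E)%E -> nonneg_vec x -> 0 < h ->
  f (x + h *: unit_vec i) - f x <= h * C.
Proof.
move=> fEL fC x0 h0; apply: le_trans (increment_le_at0 i fEL x0 h0) _.
have z0 : nonneg_vec (0 : 'rV[R]_n) by move=> j; rewrite mxE.
have := le_trans (right_partial_ge i fEL z0 h0)
  (le_trans (le_bigmax _ (fun i => right_partial f i 0) i) fC).
by rewrite lee_fin ler_pdivrMr // mulrC.
Qed.

End EntropyLike.

(** * Geometry of the simplex *)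

Section Hyperplane.
Set Implicit Arguments.
Unset Strict Implicit.
Context {R : realType} {n : nat} (c : 'I_n -> R) (M : R).
Context (hn : (0 < n)%N) (hc : forall i, 0 < c i) (hM : 0 < M).
Implicit Types (x y : 'rV[R]_n) (i j a b : 'I_n) (f : 'rV[R]_n -> R).

Definition weight x : R := \sum_(i < n) c i * x 0 i.

Definition simplex : set 'rV[R]_n := [set x | nonneg_vec x /\ weight x = M].

(** A point of the simplex with all coordinates positive, where the staircase
    starts. *)
Definition center : 'rV[R]_n := \row_i (M / (n%:R * c i)).

Lemma weightD x y : weight (x + y) = weight x + weight y.
Proof. by rewrite -big_split; apply: eq_bigr => i _; rewrite mxE mulrDr. Qed.

Lemma weightZunit (t : R) i : weight (t *: unit_vec i) = t * c i.
Proof.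
rewrite /weight (bigD1 i) //= big1 ?addr0.
  by rewrite mxE unit_vecE eqxx mulr1 mulrC.
by move=> j ji; rewrite mxE unit_vecE (negPf ji) !mulr0.
Qed.

Lemma weight0 : weight 0 = 0.
Proof. by rewrite /weight big1 // => i _; rewrite mxE mulr0. Qed.

Lemma center_gt0 i : 0 < center 0 i.
Proof. by rewrite mxE divr_gt0 // mulr_gt0 // ltr0n. Qed.

Lemma weight_center : weight center = M.
Proof.
have n0 : n%:R != 0 :> R by rewrite pnatr_eq0 -lt0n.
rewrite /weight (eq_bigr (fun=> M / n%:R)) => [|i _].
  by rewrite sumr_const card_ord -[_ *+ n]mulr_natr divfK.
by rewrite mxE; field; rewrite n0 lt0r_neq0.
Qed.

(** * The lower bound *)

(** This settles the case where all c_i are equal, in particular n = 1, where no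
    two distinct directions are available: one second difference suffices. *)
Lemma cost_ge1 f (C : R) : feasible simplex f -> (Cost f <= C%:E)%E -> 1 <= C.
Proof.
move=> [fEL drop] fC; pose i := Ordinal hn.
have p0 : nonneg_vec center by move=> j; rewrite ltW // center_gt0.
have h0 := center_gt0 i; set h := center 0 i in h0.
have := second_difference_ge fEL p0 h0 (lexx _)
  (drop i _ (conj p0 weight_center) center_gt0).
have q0 : nonneg_vec (center - h *: unit_vec i).
  by rewrite -scaleNr; apply: nonneg_addZunit => //; rewrite subrr.
have := increment_le_cost i fEL fC q0 h0; rewrite -addrA addNr addr0.
have [_ _ fm _] := fEL.
have : f center <= f (center + h *: unit_vec i).
  rewrite -{1}[center]addr0 -(scale0r (unit_vec i)).
  by apply: nondecreasing_unit => //; rewrite ?addr0 // ltW.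
move=> ? ? ?; have : h * 1 <= h * C by lra.
by rewrite ler_pM2l.
Qed.

(** The discrete form of the fact that the gradient jumps along the normal c:
    the right-hand side does not depend on N. *)
Lemma staircase f (C : R) a b (N : nat) : feasible simplex f ->
  (Cost f <= C%:E)%E -> a != b ->
  N.+1%:R * (c a / c b - C) <= C * (1 + c a / c b).
Proof.
move=> [fEL drop] fC ab; have [_ _ fm _] := fEL.
set k := c a / c b.
have k0 : 0 < k by rewrite divr_gt0.
(* The staircase visits P 1 1, ..., P N.+1 N.+1, and the lowest point used,
   P N.+1 N.+2, must still have a positive b-coordinate: the step k * h is
   the N.+3-th part of that of the center. *)
have [h h0 hE] : exists2 h, 0 < h & N.+3%:R * (k * h) = center 0 b.
  exists (center 0 b / (k * N.+3%:R)).
    by rewrite divr_gt0 ?center_gt0 // mulr_gt0.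
  by field; rewrite !lt0r_neq0.
have kh0 : 0 < k * h by rewrite mulr_gt0.
pose P (i j : nat) : 'rV[R]_n :=
  center + (i%:R * h) *: unit_vec a + (- (j%:R * (k * h))) *: unit_vec b.
have PE (i j : nat) l : P i j 0 l = center 0 l + i%:R * h * (l == a)%:R
    - j%:R * (k * h) * (l == b)%:R.
  by rewrite /P !addZunitE mulNr.
have PM (i : nat) : weight (P i i) = M.
  rewrite /P !weightD !weightZunit weight_center /k; field.
  exact: lt0r_neq0.
clearbody P.
have Pge (i j : nat) l : center 0 l - j%:R * (k * h) * (l == b)%:R <= P i j 0 l.
  by rewrite PE lerD2r lerDl !mulr_ge0 // ltW.
have Pgt0 (i j : nat) : (j <= N.+2)%N -> forall l, 0 < P i j 0 l.
  move=> jN l; apply: lt_le_trans (Pge i j l).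
  case: (eqVneq l b) => [->|_]; last by rewrite mulr0 subr0 center_gt0.
  by rewrite mulr1 -hE subr_gt0 ltr_pM2r // ltr_nat.
have Pnn (i j : nat) : (j <= N.+2)%N -> nonneg_vec (P i j).
  by move=> jN l; exact/ltW/Pgt0.
have PSl (i j : nat) : P i.+1 j = P i j + h *: unit_vec a.
  by apply/rowP => l; rewrite PE [RHS]addZunitE PE -[i.+1%:R]natr1; ring.
have PSr (i j : nat) : P i j = P i j.+1 + (k * h) *: unit_vec b.
  by apply/rowP => l; rewrite PE [RHS]addZunitE PE -[j.+1%:R]natr1; ring.
have PSrN (i j : nat) : P i j.+1 = P i j - (k * h) *: unit_vec b.
  by rewrite [P i j]PSr addrK.
have PS (i : nat) : (i <= N.+2)%N -> simplex (P i i).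
  by move=> iN; split; [exact: Pnn | exact: PM].
(* The second differences at P i.+1 i.+1 along b and along a share the value
   at that point; what remains of their difference is U i.+1 - U i. *)
pose U (i : nat) := f (P i.+1 i) - f (P i i.+1).
have stepU (i : nat) : (i <= N)%N -> k * h <= h * C + (U i.+1 - U i).
  move=> iN.
  have i1N : (i.+1 <= N.+2)%N by rewrite leqW.
  have khle : k * h <= P i.+1 i.+1 0 b.
    apply: le_trans (Pge _ _ _); rewrite eqxx mulr1 -hE.
    have : i.+2%:R * (k * h) <= N.+3%:R * (k * h).
      by rewrite ler_pM2r // ler_nat ltnS leqW.
    by rewrite -[i.+2%:R]natr1; lra.
  have := second_difference_ge fEL (Pnn i.+1 i.+1 i1N) kh0 khle
    (drop b _ (PS _ i1N) (Pgt0 _ _ i1N)).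
  rewrite -PSrN -PSr.
  have := increment_le_cost a fEL fC (Pnn i i.+1 i1N) h0; rewrite -PSl.
  have : f (P i.+1 i.+1) <= f (P i.+2 i.+1).
    apply: fm => [|l]; first exact: Pnn.
    by rewrite [P i.+2 _]PSl addZunitE lerDl mulr_ge0 // ltW.
  rewrite /U; lra.
have sumU m : (m <= N.+1)%N -> m%:R * (k * h) <= m%:R * (h * C) + (U m - U 0%N).
  elim: m => [|m IH] mN; first by rewrite !mul0r add0r subrr.
  by have := IH (ltnW mN); have := stepU m mN; rewrite -[m.+1%:R]natr1; lra.
have U0 : 0 <= U 0%N.
  rewrite subr_ge0; apply: fm => [|l]; first exact: Pnn.
  rewrite PSl [P 0 0]PSr !addZunitE -addrA lerDl.
  by rewrite addr_ge0 // mulr_ge0 // ltW.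
have UN : U N.+1 <= h * C + k * h * C.
  have := increment_le_cost a fEL fC (Pnn N.+1 N.+1 (leqnSn _)) h0.
  have := increment_le_cost b fEL fC (Pnn N.+1 N.+2 (leqnn _)) kh0.
  by rewrite -PSr -PSl /U; lra.
rewrite -(ler_pM2l h0); have := sumU N.+1 (leqnn _); lra.
Qed.

Lemma cost_ge_ratio f (C : R) a b : feasible simplex f ->
  (Cost f <= C%:E)%E -> c a / c b <= C.
Proof.
move=> ff fC; have [->|ab] := eqVneq a b.
  by rewrite divff ?lt0r_neq0 //; exact: cost_ge1 ff fC.
rewrite -subr_le0; apply: (le0_of_bounded_multiples _ _ (C * (1 + c a / c b))) => N.
exact: staircase ff fC ab.
Qed.

(** * The upper bound *)

Definition truncated_weight (m : R) x : R := Num.min (weight x) M / m.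

Lemma weight_homo x y : le_vec x y -> weight x <= weight y.
Proof. by move=> xy; apply: ler_sum => i _; rewrite ler_wpM2l // ltW. Qed.

(** A concave nondecreasing function of a linear form with nonnegative
    coefficients: min_vec x y and max_vec x y have the same total weight as
    x and y, and are further apart. *)
Lemma truncated_weight_EL (m : R) : 0 < m -> entropy_like (truncated_weight m).
Proof.
move=> m0; have im0 : 0 <= m^-1 by rewrite invr_ge0 ltW.
split.
- move=> x y _ _; rewrite -!mulrDl ler_wpM2r //.
  apply: min_decreasing_increments.
  + by apply: weight_homo => i; rewrite mxE ge_min lexx.
  + by apply: weight_homo => i; rewrite mxE ge_min lexx orbT.
  rewrite -!big_split; apply: eq_bigr => i _ /=; rewrite !mxE -!mulrDr.
  by rewrite addr_min_max.
- by rewrite /truncated_weight weight0 min_l ?mul0r // ltW.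
- move=> x y _ xy; rewrite ler_wpM2r //.
  by rewrite le_min !ge_min lexx weight_homo // orbT.
- move=> x i l e _ l0 e0 /=; rewrite -!mulrBl ler_wpM2r // !weightD !weightZunit.
  have lc := mulr_gt0 l0 (hc i); have ec := mulr_gt0 e0 (hc i).
  suff : Num.min (weight x) M + Num.min (weight x + l * c i + e * c i) M <=
      Num.min (weight x + l * c i) M + Num.min (weight x + e * c i) M by lra.
  by apply: min_decreasing_increments; lra.
Qed.

Lemma truncated_weight_right_below (m : R) x i : weight x < M ->
  right_partial (truncated_weight m) i x = (c i / m)%:E.
Proof.
move=> xM; apply: lim_near_cst; first exact: ereal_hausdorff.
near=> e; congr (_%:E).
have e0 : 0 < e by [].
have eM : e <= (M - weight x) / c i.
  by near: e; apply: nbhs_right_le; rewrite divr_gt0 // subr_gt0.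
rewrite ler_pdivlMr // in eM.
rewrite /truncated_weight weightD weightZunit -mulrBl !min_l //; last 2 first.
- exact: ltW.
- lra.
by rewrite addrAC subrr add0r mulrAC [e * _]mulrC mulfK // lt0r_neq0.
Unshelve. all: by end_near. Qed.

Lemma truncated_weight_right_on (m : R) x i : weight x = M ->
  right_partial (truncated_weight m) i x = 0%E.
Proof.
move=> xM; apply: lim_near_cst; first exact: ereal_hausdorff.
near=> e; congr (_%:E).
have e0 : 0 < e by [].
have eci := mulr_gt0 e0 (hc i).
rewrite /truncated_weight weightD weightZunit xM !min_r ?lexx //; last lra.
by rewrite subrr mul0r.
Unshelve. all: by end_near. Qed.

Lemma truncated_weight_left_on (m : R) x i : weight x = M ->
  left_partial (truncated_weight m) i x = (c i / m)%:E.
Proof.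
move=> xM; apply: lim_near_cst; first exact: ereal_hausdorff.
near=> e; congr (_%:E).
have e0 : 0 < e by [].
have eci := mulr_gt0 e0 (hc i).
rewrite /truncated_weight -[- (e *: _)]scaleNr weightD weightZunit xM -mulrBl minxx.
rewrite min_l; last lra.
rewrite (_ : M - (M + - e * c i) = c i * e); last by ring.
by rewrite mulrAC mulfK // lt0r_neq0.
Unshelve. all: by end_near. Qed.

Lemma truncated_weight_feasible (m : R) : 0 < m -> (forall i, m <= c i) ->
  feasible simplex (truncated_weight m).
Proof.
move=> m0 mc; split; first exact: truncated_weight_EL.
move=> i x [_ xM] _; rewrite truncated_weight_left_on //.
by rewrite truncated_weight_right_on // sube0 lee_fin ler_pdivlMr // mul1r.
Qed.

Lemma truncated_weight_cost (m t : R) : 0 < m -> (forall i, c i <= t) ->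
  (Cost (truncated_weight m) <= (t / m)%:E)%E.
Proof.
move=> m0 ct; apply: bigmax_le; first by rewrite leNye.
move=> i _; rewrite truncated_weight_right_below.
  by rewrite lee_fin ler_wpM2r // invr_ge0 ltW.
by rewrite weight0.
Qed.

End Hyperplane.

(** * The theorem *)

Theorem mainTheorem2 (R : realType) (n : nat) (hn : (1 <= n)%N)
    (c : 'I_n -> R) (M : R) (hc : forall i, 0 < c i) (hM : 0 < M) :
  OPT [set x : 'rV[R]_n | nonneg_vec x /\ \sum_(i < n) c i * x 0 i = M] =
  ((\big[maxe/-oo]_(i < n) (c i)%:E) / (\big[mine/+oo]_(i < n) (c i)%:E))%E.
Proof.
pose i0 := Ordinal hn.
have [a _ aE] := @eq_bigmax _ _ _ -oo%E i0 predT (fun i => (c i)%:E) isT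
  (fun i _ => leNye _).
have [b _ bE] := @eq_bigmin _ _ _ +oo%E i0 predT (fun i => (c i)%:E) isT
  (fun i _ => leey _).
have ca i : c i <= c a.
  by rewrite -lee_fin -aE; exact: (le_bigmax _ (fun i => (c i)%:E)).
have cb i : c b <= c i.
  by rewrite -lee_fin -bE; exact: bigmin_le.
rewrite aE bE inver (gt_eqF (hc b)) -EFinM.
apply/eqP; rewrite eq_le; apply/andP; split.
  apply: le_trans (truncated_weight_cost hc hM (hc b) ca).
  by apply: ereal_inf_lbound; exists (truncated_weight c M (c b)) => //;
    exact: truncated_weight_feasible.
apply: le_ereal_inf_tmp => _ [f ff <-].
case Cf : (Cost f) => [C||]; last 2 first.
- by rewrite leey.
(* A cost -oo would be at most 0, against cost_ge1. *)
- have C1 : (Cost f <= 0%:E)%E by rewrite Cf leNye.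
  by have := cost_ge1 hn hc hM ff C1; rewrite ler10.
have fC : (Cost f <= C%:E)%E by rewrite Cf.
by have := cost_ge_ratio hn hc hM a b ff fC; rewrite lee_fin.
Qed.
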